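(* Let the standing assumptions (i)–(v) and the solvability assumption of the context hold, let $\psi=\|\cdot\|^2/2$, $\Omega=\mathbb R^n$, and let $f$ satisfy, for a constant $\mu>0$, $D_f(u,v)\ge\mu D_\psi(u,v)$ for all $u\in\operatorname{cl}\Omega$, $v\in\Omega$. Run GA-BPGsc (described in the context, with this $\mu$) with $\gamma_+=1$, $\kappa_0\ge8$, and $\kappa_0>2\mu\lambda_0$. Set $$\underline\lambda=\min\{\lambda_0,1/(\gamma_-L)\},\qquad q_{\min}=\sqrt{\frac{2\mu\underline\lambda}{\kappa_0}}.$$ Then $\lambda_k\ge\underline\lambda$ and $\kappa_k=\kappa_0$ at every completed iteration. For any minimizer $x^\star$ of $\Phi$ and $N\ge1$ (completed iterations), $$\Phi(y_N)-\Phi^\star\le\frac{\|x^\star-y_0\|^2}{2\omega_1}(1-q_{\min})^{N-1}.$$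
   Context: Notation. $\langle\cdot,\cdot\rangle$ and $\|\cdot\|$ are the Euclidean inner product and norm on $\mathbb R^n$. For $h:\mathbb R^n\to(-\infty,+\infty]$, $\operatorname{dom}h=\{h<+\infty\}$ and $h^*$ is the convex conjugate. A proper lower semicontinuous convex function is Legendre if it is essentially smooth and essentially strictly convex; then $\nabla h^*=(\nabla h)^{-1}$ on $\operatorname{int}\operatorname{dom}h^*$. For $v$ where $h$ is differentiable, $D_h(u,v)=h(u)-h(v)-\langle\nabla h(v),u-v\rangle$; the same notation is used for $f$. Standing assumptions. (i) $\psi:\mathbb R^n\to(-\infty,+\infty]$ is Legendre and $\Omega=\operatorname{int}\operatorname{dom}\psi$. (ii) $f:\mathbb R^n\to(-\infty,+\infty]$ is proper, lower semicontinuous, $\operatorname{dom}\psi\subset\operatorname{dom}f$, and $f$ is continuously differentiable on $\Omega$. (iii) $\rho:\mathbb R^n\to(-\infty,+\infty]$ is proper, lower semicontinuous, convex, with $\Omega\cap\operatorname{dom}\rho\ne\emptyset$. (iv) There is $L>0$ with $D_f(u,v)\le L D_\psi(u,v)$ for all $u,v\in\Omega$. (v) With $\Phi=f+\rho$, $\Phi^\star=\inf_{x\in\operatorname{cl}\Omega}\Phi(x)>-\infty$. BPG map. For $x\in\Omega$, $\lambda>0$, $$T_\lambda(x)=\operatorname{argmin}_{u\in\operatorname{cl}\Omega}\{\rho(u)+\langle\nabla f(x),u-x\rangle+\lambda^{-1}D_\psi(u,x)\}.$$ Solvability assumption: $T_\lambda(x)\neq\emptyset$ for every $x\in\Omega$,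 $\lambda>0$ (the minimizer is then unique and lies in $\Omega$). For $\widehat y\in T_\lambda(x)$ put $g_\lambda(x)=(\nabla\psi(x)-\nabla\psi(\widehat y))/\lambda$ and $P_\lambda(x)=\lambda^{-1}[D_\psi(x,\widehat y)+D_\psi(\widehat y,x)]-D_f(\widehat y,x)$. GA-BPGsc. Inputs: $\mu>0$; $y_0\in\Omega\cap\operatorname{dom}\rho$; $\lambda_0,\kappa_0>0$; $\gamma_+\ge1$; $\gamma_-,\gamma_\kappa>1$. Set $z_0=y_0$, $\omega_0=0$, $\theta_0=1$. For $k=1,2,\dots$: if $y_{k-1}\in T_{\lambda_{k-1}}(y_{k-1})$, stop and return $y_{k-1}$. Otherwise set $\lambda=\gamma_+\lambda_{k-1}$, $\kappa=\kappa_{k-1}/\gamma_+$, write $\omega_-=\omega_{k-1}$, $\theta_-=\theta_{k-1}$, and repeat trials: (a) if $\kappa\le2\mu\lambda$, replace $\kappa$ by $\gamma_\kappa\kappa$ and restart (a); (b) $d=\kappa-2\mu\lambda$, $\alpha=[\lambda(\theta_-+\mu\omega_-)+\sqrt{\lambda^2(\theta_-+\mu\omega_-)^2+2\lambda d\,\omega_-\theta_-}]/d$, $\omega=\omega_-+\alpha$, $\theta=\theta_-+\mu\alpha$ (so $\kappa\alpha^2=2\lambda\omega\theta$), $x=(\omega_-y_{k-1}+\alpha z_{k-1})/\omega$; (c) $\widehat y\in T_\lambda(x)$; if $\widehat y=x$, stop and return $x$; (d) if $D_f(\widehat y,x)>\lambda^{-1}D_\psi(\widehat y,x)$, replace $\lambda$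 by $\lambda/\gamma_-$ and go to (a); (e) $p=[\theta_-\nabla\psi(z_{k-1})+\mu\alpha\nabla\psi(x)-\alpha g_\lambda(x)]/\theta$; if $p\notin\operatorname{int}\operatorname{dom}\psi^*$, replace $\kappa$ by $\gamma_\kappa\kappa$ and go to (a); (f) $\widehat z=\nabla\psi^*(p)$; if $\theta D_\psi(z_{k-1},\widehat z)-\mu(\omega_-D_\psi(y_{k-1},x)+\alpha D_\psi(z_{k-1},x))>\omega P_\lambda(x)$, replace $\kappa$ by $\gamma_\kappa\kappa$ and go to (a); (g) otherwise accept: $(\alpha_k,\omega_k,\theta_k,x_k,y_k,z_k,\lambda_k,\kappa_k)=(\alpha,\omega,\theta,x,\widehat y,\widehat z,\lambda,\kappa)$. An iteration is completed when a trial is accepted. *)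

(* Defs.v *)
From HB Require Import structures.
From mathcomp Require Import all_boot all_order all_algebra.
From mathcomp Require Import all_classical all_reals all_analysis.
Set Implicit Arguments.
Unset Strict Implicit.
Unset Printing Implicit Defensive.
Import Order.TTheory GRing.Theory Num.Theory.
Import numFieldNormedType.Exports.
Local Open Scope classical_set_scope.
Local Open Scope ring_scope.

(* The norm that the library puts on 'rV[R]_n is the sup norm. It induces the
   same topology and the same differentiability as the Euclidean norm, so it is
   used for topological notions only; metric quantities use [enorm]. *)
Definition dotp (R : realType) (n : nat) (u v : 'rV[R]_n) : R :=
  \sum_(i < n) u 0 i * v 0 i.

Definition enorm (R : realType) (n : nat) (u : 'rV[R]_n) : R :=
  Num.sqrt (dotp u u).

Section ExtendedRealFunctions.
Context {R : realType} {n : nat}.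
Implicit Types (h : 'rV[R]_n -> \bar R) (C : set 'rV[R]_n) (u v x y p : 'rV[R]_n).

Definition dom h : set 'rV[R]_n := [set x | (h x < +oo)%E].

Definition proper_fun h : Prop :=
  (forall x, h x != -oo%E) /\ dom h !=set0.

Definition convex_efun h : Prop :=
  forall x y (t : R), 0 < t < 1 ->
    (h (t *: x + (1 - t) *: y)%R <= t%:E * h x + (1 - t)%:E * h y)%E.

Definition strictly_convex_on C h : Prop :=
  forall x y (t : R), C x -> C y -> x != y -> 0 < t < 1 ->
    (h (t *: x + (1 - t) *: y)%R < t%:E * h x + (1 - t)%:E * h y)%E.

(* Total: meaningful only where [h] is differentiable. *)
Definition grad h x : 'rV[R]_n :=
  \row_(j < n) 'd (fine \o h) x (delta_mx 0 j).

(* [fine] sends +oo to 0, hence the requirement that [h] be finite near [x]. *)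
Definition efun_differentiable h x : Prop :=
  interior (dom h) x /\ differentiable (fine \o h) x.

Definition C1_on C h : Prop :=
  forall x, C x -> efun_differentiable h x /\ {for x, continuous (grad h)}.

Definition conjugate h p : \bar R :=
  ereal_sup [set ((dotp p x)%:E - h x)%E | x in [set: 'rV[R]_n]].

Definition subdifferential h x : set 'rV[R]_n :=
  [set p | forall z, (h x + (dotp p (z - x)%R)%:E <= h z)%E].

Definition essentially_smooth h : Prop :=
  [/\ interior (dom h) !=set0,
      forall x, interior (dom h) x -> efun_differentiable h x &
      forall (u : nat -> 'rV[R]_n) b,
        (forall i, interior (dom h) (u i)) ->
        closure (interior (dom h)) b -> ~ interior (dom h) b ->
        u i @[i --> \oo] --> b ->
        enorm (grad h (u i)) @[i --> \oo] --> +oo].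

Definition essentially_strictly_convex h : Prop :=
  forall C, convex_set C ->
    C `<=` [set x | subdifferential h x !=set0] -> strictly_convex_on C h.

Definition legendre h : Prop :=
  [/\ proper_fun h, lower_semicontinuous h, convex_efun h,
      essentially_smooth h & essentially_strictly_convex h].

Definition bregman h u v : \bar R :=
  (h u - h v - (dotp (grad h v) (u - v)%R)%:E)%E.

End ExtendedRealFunctions.

Section BPG.
Context {R : realType} {n : nat}.
Variables (psi f rho : 'rV[R]_n -> \bar R).
Implicit Types (u v x y z p : 'rV[R]_n) (l k mu L : R).

Definition Omega : set 'rV[R]_n := interior (dom psi).

Definition Phi x : \bar R := (f x + rho x)%E.

Definition Phi_star : \bar R := ereal_inf [set Phi x | x in closure Omega].

Definition Phi_minimizer x : Prop := closure Omega x /\ Phi x = Phi_star.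

Record standing_assumptions L : Prop := StandingAssumptions {
  sa_psi_legendre : legendre psi;
  sa_f_proper : proper_fun f;
  sa_f_lsc : lower_semicontinuous f;
  sa_dom_sub : dom psi `<=` dom f;
  sa_f_C1 : C1_on Omega f;
  sa_rho_proper : proper_fun rho;
  sa_rho_lsc : lower_semicontinuous rho;
  sa_rho_convex : convex_efun rho;
  sa_rho_dom : Omega `&` dom rho !=set0;
  sa_L_gt0 : 0 < L;
  sa_L_smad : forall u v, Omega u -> Omega v ->
    (bregman f u v <= L%:E * bregman psi u v)%E;
  sa_Phi_bounded : (-oo < Phi_star)%E
}.

Definition bpg_objective l x u : \bar R :=
  (rho u + (dotp (grad f x) (u - x)%R)%:E + l^-1%:E * bregman psi u x)%E.

Definition bpg_map l x : set 'rV[R]_n :=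
  [set u | closure Omega u /\
     forall v, closure Omega v -> (bpg_objective l x u <= bpg_objective l x v)%E].

Definition bpg_solvable : Prop :=
  forall x l, Omega x -> 0 < l -> bpg_map l x !=set0.

(* In [grad_map] and [P_val], [yh] stands for an element of [bpg_map l x]. *)
Definition grad_map l x yh : 'rV[R]_n := l^-1 *: (grad psi x - grad psi yh).

Definition P_val l x yh : \bar R :=
  (l^-1%:E * (bregman psi x yh + bregman psi yh x) - bregman f yh x)%E.

Definition rel_strongly_convex mu : Prop :=
  forall u v, closure Omega u -> Omega v ->
    (mu%:E * bregman psi u v <= bregman f u v)%E.

End BPG.

Record ga_state (R : realType) (n : nat) := GAState {
  st_alpha : R; st_omega : R; st_theta : R;
  st_x : 'rV[R]_n; st_y : 'rV[R]_n; st_z : 'rV[R]_n;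
  st_lambda : R; st_kappa : R
}.

Variant ga_outcome (R : realType) (n : nat) :=
  | Stopped of 'rV[R]_n
  | Completed of ga_state R n.

Section GA_BPGsc.
Context {R : realType} {n : nat}.
Variables (psi f rho : 'rV[R]_n -> \bar R).
Variables (mu : R) (y0 : 'rV[R]_n) (lambda0 kappa0 : R).
Variables (gamma_plus gamma_minus gamma_kappa : R).
Implicit Types (s : ga_state R n) (l k : R) (x yh : 'rV[R]_n).

Definition ga_inputs : Prop :=
  [/\ 0 < mu, (Omega psi `&` dom rho) y0, 0 < lambda0 & 0 < kappa0] /\
  [/\ 1 <= gamma_plus, 1 < gamma_minus & 1 < gamma_kappa].

(* The quantities of a trial with parameters [l], [k], where [s] is the state
   at the start of the iteration. *)
Definition tr_alpha s l k : R :=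
  let d := k - 2 * mu * l in
  let om := st_omega s in
  let th := st_theta s in
  (l * (th + mu * om) +
   Num.sqrt (l ^+ 2 * (th + mu * om) ^+ 2 + 2 * l * d * om * th)) / d.

Definition tr_omega s l k : R := st_omega s + tr_alpha s l k.

Definition tr_theta s l k : R := st_theta s + mu * tr_alpha s l k.

Definition tr_x s l k : 'rV[R]_n :=
  (tr_omega s l k)^-1 *: (st_omega s *: st_y s + tr_alpha s l k *: st_z s).

Definition tr_p s l k yh : 'rV[R]_n :=
  let x := tr_x s l k in
  (tr_theta s l k)^-1 *:
    (st_theta s *: grad psi (st_z s) + (mu * tr_alpha s l k) *: grad psi x
     - tr_alpha s l k *: grad_map psi l x yh).

Definition tr_z s l k yh : 'rV[R]_n := grad (conjugate psi) (tr_p s l k yh).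

(* The computed [yh] is an element of T_l(x) that differs from x. *)
Definition tr_candidate s l k yh : Prop :=
  bpg_map psi f rho l (tr_x s l k) yh /\ yh != tr_x s l k.

Definition descent_fails s l k yh : Prop :=
  let x := tr_x s l k in (l^-1%:E * bregman psi yh x < bregman f yh x)%E.

Definition dual_point_ok s l k yh : Prop :=
  interior (dom (conjugate psi)) (tr_p s l k yh).

Definition certificate_fails s l k yh : Prop :=
  let x := tr_x s l k in
  ((tr_omega s l k)%:E * P_val psi f l x yh <
   (tr_theta s l k)%:E * bregman psi (st_z s) (tr_z s l k yh)
   - mu%:E * ((st_omega s)%:E * bregman psi (st_y s) x
              + (tr_alpha s l k)%:E * bregman psi (st_z s) x))%E.

(* [ga_trials s l k o]: the trial loop entered at step (a) with current
   parameters [l], [k] can end with outcome [o]; a loop that never ends has no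
   outcome. The constructors are the exits of steps (a), (c), (d), (e), (f), (g). *)
Inductive ga_trials s : R -> R -> ga_outcome R n -> Prop :=
| trial_a l k o :
    k <= 2 * mu * l ->
    ga_trials s l (gamma_kappa * k) o ->
    ga_trials s l k o
| trial_c l k :
    2 * mu * l < k ->
    bpg_map psi f rho l (tr_x s l k) (tr_x s l k) ->
    ga_trials s l k (Stopped (tr_x s l k))
| trial_d l k yh o :
    2 * mu * l < k ->
    tr_candidate s l k yh ->
    descent_fails s l k yh ->
    ga_trials s (l / gamma_minus) k o ->
    ga_trials s l k o
| trial_e l k yh o :
    2 * mu * l < k ->
    tr_candidate s l k yh ->
    ~ descent_fails s l k yh ->
    ~ dual_point_ok s l k yh ->
    ga_trials s l (gamma_kappa * k) o ->
    ga_trials s l k o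
| trial_f l k yh o :
    2 * mu * l < k ->
    tr_candidate s l k yh ->
    ~ descent_fails s l k yh ->
    dual_point_ok s l k yh ->
    certificate_fails s l k yh ->
    ga_trials s l (gamma_kappa * k) o ->
    ga_trials s l k o
| trial_g l k yh :
    2 * mu * l < k ->
    tr_candidate s l k yh ->
    ~ descent_fails s l k yh ->
    dual_point_ok s l k yh ->
    ~ certificate_fails s l k yh ->
    ga_trials s l k
      (Completed (GAState (tr_alpha s l k) (tr_omega s l k) (tr_theta s l k)
                          (tr_x s l k) yh (tr_z s l k yh) l k)).

Variant ga_iteration s : ga_outcome R n -> Prop :=
| iteration_stop :
    bpg_map psi f rho (st_lambda s) (st_y s) (st_y s) ->
    ga_iteration s (Stopped (st_y s))
| iteration_trials o :
    ~ bpg_map psi f rho (st_lambda s) (st_y s) (st_y s) ->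
    ga_trials s (gamma_plus * st_lambda s) (st_kappa s / gamma_plus) o ->
    ga_iteration s o.

(* alpha_0 and x_0 are not defined by the algorithm and are never read, so the
   fields [st_alpha] and [st_x] are left free here. *)
Definition ga_init s : Prop :=
  [/\ st_y s = y0, st_z s = y0, st_omega s = 0 & st_theta s = 1] /\
  [/\ st_lambda s = lambda0 & st_kappa s = kappa0].

(* [s i] is the state after i iterations, the first N of which are completed;
   the values [s i] for i > N are irrelevant. *)
Definition ga_run (N : nat) (s : nat -> ga_state R n) : Prop :=
  ga_init (s 0%N) /\
  forall i : nat, (i < N)%N -> ga_iteration (s i) (Completed (s i.+1)).

End GA_BPGsc.

(* Main.v *)
Require Import Defs.
From HB Require Import structures.
From mathcomp Require Import all_boot all_order all_algebra.
From mathcomp Require Import all_classical all_reals all_analysis.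
From mathcomp Require Import ring lra.
Set Implicit Arguments.
Unset Strict Implicit.
Import Order.TTheory GRing.Theory Num.Theory.
Import numFieldNormedType.Exports.
Local Open Scope classical_set_scope.
Local Open Scope ring_scope.

(** For the Euclidean kernel, [grad psi] and [grad (conjugate psi)] are the
    identity and [bregman psi u v = |u - v|^2 / 2], so every test of the
    algorithm is a statement about inner products. Two facts are behind the
    theorem.

    Trials never change [kappa]. Step (a) is idle because
    [2 mu l <= 2 mu lambda0 < kappa0], step (e) because the domain of the
    conjugate is the whole space, and step (f) by [certificate_bound]. That bound
    rests on the invariant [theta = 1 + mu omega] along the run: it gives
    [mu alpha / theta <= q] for the ratio [q = alpha / omega] of the new values,
    so that the error term in [|z - x|^2] is at most [2 q (1 - q) <= 1 / 2] times
    the curvature terms of the test, which absorb it. The descent test of step (d)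
    can fail only for [l > 1 / L], so [l] never drops below [lambda_min].

    An accepted trial does not increase the energy
    [omega (Phi y - Phi xs) + theta / 2 |xs - z|^2]. The first-order condition of
    the proximal step ([bpg_map_subdifferential]) gives the lower model of [Phi]
    in [prox_gap]; averaging it over [u = y] and [u = xs] with weights [omega]
    and [alpha], and adding the exact quadratic expansion of the dual update
    ([dual_update_identity]), leaves precisely the certificate of step (f).
    Since the energy starts at [|xs - y0|^2 / 2], the gap after [N] iterations is
    at most [|xs - y0|^2 / (2 omega_N)]. Finally
    [kappa alpha^2 = 2 l omega theta] and [theta >= mu omega] give
    [q^2 >= 2 mu l / kappa], hence the geometric growth of [omega]
    ([tr_omega_contraction]). *)

(** * Inner products and the Euclidean kernel *)

Section DotProduct.
Context {R : realType} {n : nat}.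
Implicit Types (u v w : 'rV[R]_n) (a : R).

Lemma dotpC u v : dotp u v = dotp v u.
Proof. by apply: eq_bigr => i _; rewrite mulrC. Qed.

Lemma dotpDl u v w : dotp (u + v) w = dotp u w + dotp v w.
Proof. by rewrite -big_split; apply: eq_bigr => i _; rewrite mxE mulrDl. Qed.

Lemma dotpZl a u w : dotp (a *: u) w = a * dotp u w.
Proof. by rewrite mulr_sumr; apply: eq_bigr => i _; rewrite mxE mulrA. Qed.

Lemma dotpNl u w : dotp (- u) w = - dotp u w.
Proof. by rewrite -scaleN1r dotpZl mulN1r. Qed.

Lemma dotpDr u v w : dotp w (u + v) = dotp w u + dotp w v.
Proof. by rewrite ![dotp w _]dotpC dotpDl. Qed.

Lemma dotpZr a u w : dotp w (a *: u) = a * dotp w u.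
Proof. by rewrite ![dotp w _]dotpC dotpZl. Qed.

Lemma dotpNr u w : dotp w (- u) = - dotp w u.
Proof. by rewrite ![dotp w _]dotpC dotpNl. Qed.

Definition dotpE := (dotpDl, dotpDr, dotpNl, dotpNr, dotpZl, dotpZr).

Lemma dotp_ge0 u : 0 <= dotp u u.
Proof. by apply: sumr_ge0 => i _; rewrite -expr2 sqr_ge0. Qed.

Lemma enorm_sqr u : enorm u ^+ 2 = dotp u u.
Proof. by rewrite sqr_sqrtr // dotp_ge0. Qed.

Lemma dotp_delta u (j : 'I_n) : dotp u (delta_mx 0 j) = u 0 j.
Proof.
rewrite /dotp (bigD1 j) //= big1 => [|i /negPf neq_ij]; rewrite mxE !eqxx.
  by rewrite mulr1 addr0.
by rewrite neq_ij mulr0.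
Qed.

End DotProduct.

Section EuclideanKernel.
Context {R : realType} {n : nat} {psi : 'rV[R]_n -> \bar R}.
Hypothesis psiE : forall x, psi x = (enorm x ^+ 2 / 2)%:E.

Lemma psi_dotp x : psi x = (dotp x x / 2)%:E.
Proof. by rewrite psiE enorm_sqr. Qed.

(** [grad] is defined through the total differential; since the directional
    derivative agrees with it, the difference quotient
    [<x, e_j> + h |e_j|^2 / 2] gives the coordinates. *)
Lemma grad_psi x : efun_differentiable psi x -> grad psi x = x.
Proof.
move=> [_ dpsi]; apply/rowP => j; rewrite mxE -deriveE // /derive.
set e := delta_mx 0 j.
apply: cvg_lim; first exact: norm_hausdorff.
have lim_affine : dotp x e + h * (dotp e e / 2) @[h --> (0 : R)^'] --> x 0 j.
  rewrite -[x in X in _ --> X]addr0 -[X in _ --> X]dotp_delta addr0 -/e.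
  rewrite -[X in _ --> X]addr0 -[X in _ --> _ + X](mul0r (dotp e e / 2)).
  apply: cvgD; first exact: cvg_cst.
  apply: cvgM; last exact: cvg_cst.
  exact: nbhs_dnbhs.
apply: cvg_trans lim_affine; apply: near_eq_cvg; near=> h.
have h_neq0 : h != 0 by near: h; exact: nbhs_dnbhs_neq.
rewrite /= !psi_dotp /= [_ *: _ + x]addrC /GRing.scale /= !dotpE (dotpC e x).
by field.
Unshelve. all: by end_near.
Qed.

Lemma bregman_psi x u : efun_differentiable psi x ->
  bregman psi u x = (dotp (u - x) (u - x) / 2)%:E.
Proof.
move=> dpsi; rewrite /bregman (grad_psi dpsi) !psi_dotp -!EFinB.
by rewrite !dotpE (dotpC u x); congr EFin; field.
Qed.

(** The supremum of [<p, x> - |x|^2 / 2] is attained at [x = p]. *)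
Lemma conjugate_psi : conjugate psi = psi.
Proof.
apply/funext => p; apply/eqP; rewrite eq_le; apply/andP; split.
  apply: ge_ereal_sup => _ [x _ <-]; rewrite !psi_dotp -EFinB lee_fin.
  have := dotp_ge0 (p - x); rewrite !dotpE (dotpC x p); lra.
apply: ereal_sup_ubound; exists p => //.
by rewrite !psi_dotp -EFinB; congr EFin; field.
Qed.

End EuclideanKernel.

(** * Quadratic estimates behind the certificate and the energy *)

Section Geometry.
Context {R : realType} {n : nat}.
Implicit Types (x y z g : 'rV[R]_n) (mu l k om alpha theta : R).

Lemma dotp_sqr_addr_le x y :
  dotp (x + y) (x + y) <= 2 * dotp x x + 2 * dotp y y.
Proof. by have := dotp_ge0 (x - y); rewrite !dotpE (dotpC y x); lra. Qed.

(** The point [z'] minimizes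
    [theta / 2 |u - z|^2 + mu alpha / 2 |u - x|^2 + alpha <g, u>], a quadratic of
    curvature [theta']: both sides compare its values at [xs] and at [z] with its
    minimum. *)
Lemma dual_update_identity theta mu alpha (theta' : R) x z z' g xs :
  theta' = theta + mu * alpha ->
  theta' *: z' = theta *: z + (mu * alpha) *: x - alpha *: g ->
  theta' / 2 * dotp (xs - z') (xs - z') =
  theta / 2 * dotp (xs - z) (xs - z)
  + mu * alpha / 2 * (dotp (xs - x) (xs - x) - dotp (z - x) (z - x))
  + alpha * dotp g (xs - z) + theta' / 2 * dotp (z - z') (z - z').
Proof.
move=> thetaE z'E.
have gE : alpha *: g = theta *: z + (mu * alpha) *: x - theta' *: z'.
  by rewrite z'E opprB addrC subrK.
rewrite -(dotpZl alpha) gE thetaE !dotpE.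
rewrite (dotpC z xs) (dotpC z' xs) (dotpC x xs) (dotpC z' z) (dotpC x z).
by field.
Qed.

(** Write [|mu (z - x) + g|^2 <= 2 mu^2 |z - x|^2 + 2 |g|^2]. The equation for
    [alpha] and [k >= 4] let the right-hand side absorb the term in [g]. As
    [x] is the weighted mean of [y] and [z], the term in [z - x] is absorbed by the
    curvature terms as soon as
    [2 mu om alpha <= (om + alpha) theta'], which follows from
    [mu (om + alpha) <= theta'] and [2 om alpha <= (om + alpha)^2]. *)
Lemma certificate_bound om alpha mu k l (theta' : R) x y z z' g :
  0 < mu -> 0 < alpha -> 0 <= om -> 4 <= k ->
  mu * (om + alpha) <= theta' ->
  k * alpha ^+ 2 = 2 * l * (om + alpha) * theta' ->
  om *: (y - x) + alpha *: (z - x) = 0 ->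
  theta' *: (z - z') = alpha *: (mu *: (z - x) + g) ->
  theta' * (dotp (z - z') (z - z') / 2)
  - mu * (om * (dotp (y - x) (y - x) / 2) + alpha * (dotp (z - x) (z - x) / 2))
  <= (om + alpha) * (l * dotp g g / 2).
Proof.
move=> mu0 al0 om0 k4 th_ge kE xE z'E.
have om'0 : 0 < om + alpha by lra.
have th0 : 0 < theta' by apply: lt_le_trans th_ge; apply: mulr_gt0.
set A := dotp (y - x) _; set B := dotp (z - x) _; set G := dotp g g.
have A0 : 0 <= A by apply: dotp_ge0.
have B0 : 0 <= B by apply: dotp_ge0.
have G0 : 0 <= G by apply: dotp_ge0.
have z'_le : theta' ^+ 2 * dotp (z - z') (z - z') <=
             alpha ^+ 2 * (2 * (mu ^+ 2 * B) + 2 * G).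
  have -> : theta' ^+ 2 * dotp (z - z') (z - z') =
            dotp (theta' *: (z - z')) (theta' *: (z - z')).
    by rewrite !(dotpZl, dotpZr) mulrA expr2.
  rewrite z'E !(dotpZl alpha, dotpZr alpha) mulrA -expr2.
  apply: ler_wpM2l; first exact: sqr_ge0.
  apply: le_trans (dotp_sqr_addr_le _ _) _.
  by rewrite !(dotpZl, dotpZr) [mu * (mu * _)]mulrA -expr2.
have omA : om ^+ 2 * A = alpha ^+ 2 * B.
  have /eqP : om *: (y - x) = - (alpha *: (z - x)).
    by apply/eqP; rewrite -addr_eq0; apply/eqP.
  move=> /eqP e; have := congr1 (fun w => dotp w w) e.
  by rewrite /= dotpNl dotpNr opprK !(dotpZl, dotpZr) !mulrA -!expr2.
have G_le : 2 * alpha ^+ 2 * G <= theta' * (om + alpha) * l * G.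
  apply: ler_wpM2r => //.
  have : 4 * alpha ^+ 2 <= k * alpha ^+ 2.
    by apply: ler_wpM2r => //; apply: sqr_ge0.
  by rewrite kE; lra.
have B_le : 2 * alpha ^+ 2 * (mu ^+ 2 * B) <=
            mu * theta' * (om * A + alpha * B).
  (* In the first iteration om = 0, so x = z and the term vanishes; otherwise the
     inequality may be multiplied by om to use omA. *)
  have [om_eq0|om_neq0] := eqVneq om 0.
    have -> : B = 0.
      move: omA; rewrite om_eq0 expr0n mul0r => /esym/eqP.
      by rewrite mulf_eq0 sqrf_eq0 gt_eqF //= => /eqP.
    by rewrite !mulr0 addr0 !mulr_ge0 // ltW.
  have om_gt0 : 0 < om by rewrite lt_neqAle eq_sym om_neq0.
  rewrite -(ler_pM2l om_gt0).
  have -> : om * (mu * theta' * (om * A + alpha * B)) =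
            (om + alpha) * theta' * (mu * alpha * B).
    transitivity (mu * theta' * (om ^+ 2 * A + om * alpha * B)); first by ring.
    by rewrite omA; ring.
  have -> : om * (2 * alpha ^+ 2 * (mu ^+ 2 * B)) =
            2 * mu * om * alpha * (mu * alpha * B) by ring.
  apply: ler_wpM2r; first by rewrite !mulr_ge0 // ltW.
  have : (om + alpha) * (mu * (om + alpha)) <= (om + alpha) * theta'.
    by apply: ler_wpM2l => //; apply: ltW.
  apply: le_trans.
  have : 0 <= mu * (om ^+ 2 + alpha ^+ 2).
    by rewrite mulr_ge0 // ?ltW // addr_gt0 // exprn_gt0.
  lra.
rewrite -(ler_pM2l th0); move: z'_le G_le B_le.
set Z := dotp (z - z') _.
have -> : theta' * (theta' * (Z / 2) - mu * (om * (A / 2) + alpha * (B / 2))) =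
  (theta' ^+ 2 * Z - mu * theta' * (om * A + alpha * B)) / 2 by field.
have -> : theta' * ((om + alpha) * (l * G / 2)) =
  theta' * (om + alpha) * l * G / 2 by field.
lra.
Qed.

End Geometry.

(** * The scalar parameters of a trial *)

Section TrialParameters.
Context {R : realType} {n : nat}.
Variables (mu l k : R) (s : ga_state R n).
Hypotheses (mu_gt0 : 0 < mu) (l_gt0 : 0 < l) (k_gt : 2 * mu * l < k).
Hypotheses (omega_ge0 : 0 <= st_omega s) (theta_gt0 : 0 < st_theta s).

Local Notation om := (st_omega s).
Local Notation th := (st_theta s).
Local Notation alpha := (tr_alpha mu s l k).
Local Notation omega' := (tr_omega mu s l k).
Local Notation theta' := (tr_theta mu s l k).

Lemma tr_alpha_gt0 : 0 < alpha.
Proof.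
have d0 : 0 < k - 2 * mu * l by rewrite subr_gt0.
apply: divr_gt0 => //; apply: ltr_pwDl; last exact: sqrtr_ge0.
by rewrite mulr_gt0 // ltr_pwDl // mulr_ge0 // ltW.
Qed.

Lemma tr_omega_gt0 : 0 < omega'.
Proof. exact: ltr_wpDl omega_ge0 tr_alpha_gt0. Qed.

Lemma tr_theta_gt0 : 0 < theta'.
Proof. by rewrite ltr_wpDr // mulr_ge0 // ltW // tr_alpha_gt0. Qed.

(** [tr_alpha] is the positive root of
    [d a^2 - 2 l (th + mu om) a - 2 l om th], where [d = k - 2 mu l]. *)
Lemma tr_alpha_eq : k * alpha ^+ 2 = 2 * l * omega' * theta'.
Proof.
have d0 : 0 < k - 2 * mu * l by rewrite subr_gt0.
set a := l * (th + mu * om).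
set D := l ^+ 2 * (th + mu * om) ^+ 2 + 2 * l * (k - 2 * mu * l) * om * th.
have D0 : 0 <= D.
  apply: addr_ge0; first by rewrite -exprMn sqr_ge0.
  by rewrite !mulr_ge0 // ltW.
have dalE : (k - 2 * mu * l) * alpha = a + Num.sqrt D.
  by rewrite /tr_alpha -/D -/a; field; rewrite gt_eqF.
have sqE : ((k - 2 * mu * l) * alpha - a) ^+ 2 = D.
  by rewrite dalE addrAC subrr add0r sqr_sqrtr.
apply: (mulfI (lt0r_neq0 d0)).
rewrite /tr_omega /tr_theta; move: sqE; rewrite /D /a.
set al := alpha; set d := k - _ => sqE.
have kE : k = d + 2 * mu * l by rewrite /d; ring.
apply/eqP; rewrite -subr_eq0; apply/eqP; move/eqP: sqE.
rewrite -subr_eq0 => /eqP sqE; rewrite -[RHS]sqE kE; ring.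
Qed.

Lemma tr_x_balance :
  om *: (st_y s - tr_x mu s l k) + alpha *: (st_z s - tr_x mu s l k) = 0.
Proof.
rewrite !scalerBr addrACA -opprD -scalerDl -/(tr_omega mu s l k).
by rewrite /tr_x scalerA divff ?scale1r ?subrr // gt_eqF // tr_omega_gt0.
Qed.

(** [alpha / omega'] is at least [Num.sqrt c]: replace one factor [theta'] by its
    lower bound [mu * omega'] in [tr_alpha_eq]. *)
Lemma tr_omega_contraction c :
  mu * omega' <= theta' -> 0 < k -> c <= 2 * mu * l / k ->
  om <= (1 - Num.sqrt c) * omega'.
Proof.
move=> th_ge k0 c_le; have om0 := tr_omega_gt0; have al0 := tr_alpha_gt0.
have sqrt_le : Num.sqrt c <= alpha / omega'.
  have q0 : 0 <= alpha / omega' by rewrite divr_ge0 // ltW.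
  rewrite -[leRHS]ger0_norm // -sqrtr_sqr; apply: ler_wsqrtr.
  apply: le_trans c_le _; rewrite expr_div_n ler_pdivrMr // [leRHS]mulrAC.
  rewrite ler_pdivlMr ?exprn_gt0 // [leRHS]mulrC tr_alpha_eq.
  have -> : 2 * mu * l * omega' ^+ 2 = 2 * l * omega' * (mu * omega') by ring.
  by rewrite ler_pM2l // !mulr_gt0.
rewrite mulrBl mul1r lerBrDr -[leRHS]/(om + alpha) lerD2l.
by rewrite -ler_pdivlMr.
Qed.

End TrialParameters.

(** * First-order condition of the proximal step *)

Section BregmanProximalStep.
Context {R : realType} {n : nat} (psi f rho : 'rV[R]_n -> \bar R).
Hypothesis psiE : forall x, psi x = (enorm x ^+ 2 / 2)%:E.
Hypothesis psi_diff : forall x, efun_differentiable psi x.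
Hypothesis Omega_setT : Omega psi = setT.
Hypotheses (rho_proper : proper_fun rho) (rho_convex : convex_efun rho).

Lemma bpg_objectiveE l x u : bpg_objective psi f rho l x u =
  (rho u + (dotp (grad f x) (u - x) + l^-1 * (dotp (u - x) (u - x) / 2))%:E)%E.
Proof. by rewrite /bpg_objective (bregman_psi psiE) // -EFinM -addeA -EFinD. Qed.

Lemma bpg_map_dom l x yh : bpg_map psi f rho l x yh -> dom rho yh.
Proof.
move=> [_ yh_min]; have [_ [y rho_y]] := rho_proper.
have := yh_min y; rewrite Omega_setT closureT => /(_ I).
rewrite !bpg_objectiveE /dom /=; move: rho_y; rewrite /dom /=.
have := rho_proper.1 y; have := rho_proper.1 yh.
by case: (rho y) (rho yh) => [b| |] [a| |] //= *; rewrite ltry.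
Qed.

(** Compare the minimizer [yh] with [yh + t (u - yh)]: convexity of [rho] bounds
    the increment of the objective by [t S + O(t^2)], where [S >= 0] is the
    subgradient inequality at [u]; then let [t] tend to [0]. *)
Lemma bpg_map_subdifferential l x yh : 0 < l -> bpg_map psi f rho l x yh ->
  subdifferential rho yh (grad_map psi l x yh - grad f x).
Proof.
move=> l0 yhP u; have rho_yh := bpg_map_dom yhP.
rewrite /grad_map !(grad_psi psiE) //.
have ryh_neq := rho_proper.1 yh; have ru_neq := rho_proper.1 u.
move: rho_yh; rewrite /dom /=.
case ryhE: (rho yh) ryh_neq => [a| |] // _ _.
case ruE: (rho u) ru_neq => [b| |] // _; last by rewrite leey.
rewrite -EFinD lee_fin.
(* An opaque w, so that dotpE leaves it alone. *)
set G := grad f x; have [w wE] : exists w, w = u - yh by exists (u - yh).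
rewrite -wE.
set S := b - a - dotp (l^-1 *: (x - yh) - G) w.
have key t : 0 < t < 1 -> 0 <= S + t * (l^-1 * (dotp w w / 2)).
  move=> t01; have t0 : 0 < t by case/andP: t01.
  have [_ /(_ (t *: u + (1 - t) *: yh))] := yhP.
  rewrite Omega_setT closureT => /(_ I); rewrite !bpg_objectiveE.
  have := rho_convex u yh t01; rewrite ryhE ruE.
  have -> : t *: u + (1 - t) *: yh = yh + t *: w.
    by rewrite wE scalerBr scalerBl scale1r addrCA addrA.
  case: (rho _) => [c| |] //; rewrite -!EFinM -!EFinD !lee_fin -/G.
  have -> : yh + t *: w - x = (yh - x) + t *: w by rewrite addrAC.
  move=> c_le; rewrite !(dotpDl, dotpDr G) => min_le.
  rewrite -(pmulr_rge0 _ t0) /S !dotpE.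
  move: min_le; rewrite !dotpE (dotpC w yh) (dotpC w x).
  lra.
have : 0 <= S.
  rewrite leNgt; apply/negP => S0.
  have B0 : 0 <= l^-1 * (dotp w w / 2).
    by rewrite mulr_ge0 // ?invr_ge0 ?divr_ge0 ?dotp_ge0 // ltW.
  move: key B0; set B := _ * _ => key B0.
  (* For S < 0 the step t = - S / (B + 1 - S) in (0, 1) makes S + t B < 0. *)
  have den_gt0 : 0 < B + 1 - S by lra.
  have := key (- S / (B + 1 - S)); rewrite ltr_pdivrMr // divr_gt0 ?oppr_gt0 //.
  have -> : S + - S / (B + 1 - S) * B = S * (1 - S) / (B + 1 - S).
    by field; rewrite gt_eqF.
  rewrite pmulr_lge0 ?invr_gt0 // nmulr_rge0 // => /(_ _).
  have -> : true && (- S < 1 * (B + 1 - S)) by rewrite /=; lra.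
  by move=> /(_ isT); lra.
by rewrite /S; lra.
Qed.

End BregmanProximalStep.

(** * Behaviour of the iteration *)

Section Convergence.
Context {R : realType} {n : nat} (psi f rho : 'rV[R]_n -> \bar R).
Variables (L mu lambda0 kappa0 gamma_minus gamma_kappa : R).
Hypothesis psiE : forall x, psi x = (enorm x ^+ 2 / 2)%:E.
Hypothesis Omega_setT : Omega psi = setT.
Hypothesis standing : standing_assumptions psi f rho L.
Hypothesis mu_gt0 : 0 < mu.
Hypothesis f_strong : rel_strongly_convex psi f mu.
Hypotheses (kappa0_ge8 : 8 <= kappa0) (kappa0_gt : 2 * mu * lambda0 < kappa0).
Hypotheses (lambda0_gt0 : 0 < lambda0) (gamma_minus_gt1 : 1 < gamma_minus).

Implicit Types (s : ga_state R n) (x y u v yh xs : 'rV[R]_n) (l : R).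

Let lambda_min := Num.min lambda0 (1 / (gamma_minus * L)).
Let q_min := Num.sqrt (2 * mu * lambda_min / kappa0).

Let psi_diff x : efun_differentiable psi x.
Proof.
have [_ _ _ [_ h _] _] := sa_psi_legendre standing.
by apply: h; move: Omega_setT; rewrite /Omega => ->.
Qed.

Let L_gt0 : 0 < L := sa_L_gt0 standing.

Lemma lambda_min_gt0 : 0 < lambda_min.
Proof.
by rewrite lt_min lambda0_gt0 divr_gt0 // mulr_gt0 // (lt_trans ltr01).
Qed.

Lemma fin_f x : (fine (f x))%:E = f x.
Proof.
apply: fineK; rewrite fin_numE (sa_f_proper standing).1 /=.
have : dom f x by apply: (sa_dom_sub standing); rewrite /dom /= psiE ltry.
by rewrite /dom /= lt_neqAle => /andP[].
Qed.

Lemma fin_rho x : dom rho x -> (fine (rho x))%:E = rho x.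
Proof.
rewrite /dom /= lt_neqAle => /andP[x_lt _].
by apply: fineK; rewrite fin_numE (sa_rho_proper standing).1.
Qed.

Let phi x : R := fine (f x) + fine (rho x).
Let Df u v : R := fine (f u) - fine (f v) - dotp (grad f v) (u - v).

Lemma Phi_fin x : dom rho x -> Phi f rho x = (phi x)%:E.
Proof. by move=> xd; rewrite /Phi -fin_f -fin_rho // -EFinD. Qed.

Lemma bregman_f u v : bregman f u v = (Df u v)%:E.
Proof. by rewrite /bregman -(fin_f u) -(fin_f v) -!EFinB. Qed.

Let bregman_psiE u v := bregman_psi psiE u (psi_diff v).

Lemma Df_le u v : Df u v <= L * (dotp (u - v) (u - v) / 2).
Proof.
have := sa_L_smad standing (u := u) (v := v).
by rewrite Omega_setT bregman_f bregman_psiE -EFinM lee_fin; apply.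
Qed.

Lemma Df_ge u v : mu * (dotp (u - v) (u - v) / 2) <= Df u v.
Proof.
have := @f_strong u v.
by rewrite Omega_setT closureT bregman_f bregman_psiE -EFinM lee_fin; apply.
Qed.

Let gmap l x yh : 'rV[R]_n := l^-1 *: (x - yh).
Let P l x yh : R := l * dotp (gmap l x yh) (gmap l x yh) - Df yh x.

Lemma grad_mapE l x yh : grad_map psi l x yh = gmap l x yh.
Proof. by rewrite /grad_map !(grad_psi psiE). Qed.

Lemma dotp_gmap l x yh : 0 < l ->
  l * dotp (gmap l x yh) (gmap l x yh) = l^-1 * dotp (yh - x) (yh - x).
Proof.
move=> l0; rewrite -[yh - x]opprB dotpNl dotpNr opprK /gmap dotpZl dotpZr.
by field; rewrite gt_eqF.
Qed.

Lemma P_valE l x yh : 0 < l -> P_val psi f l x yh = (P l x yh)%:E.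
Proof.
move=> l0; rewrite /P_val !bregman_psiE bregman_f.
rewrite -(EFinD (dotp _ _ / 2)) -EFinM -EFinB.
congr EFin; rewrite /P dotp_gmap //.
rewrite -[x - yh]opprB dotpNl dotpNr opprK; field; rewrite gt_eqF //.
Qed.

(** Lower model of [Phi] at [u]: the subgradient inequality of [rho] at [yh] plus
    the strong convexity of [f] at [x]; the gradients of [f] cancel. *)
Lemma prox_gap l x yh u : 0 < l -> bpg_map psi f rho l x yh -> dom rho u ->
  phi yh + dotp (gmap l x yh) (u - x) + P l x yh
    + mu * (dotp (u - x) (u - x) / 2) <= phi u.
Proof.
move=> l0 yhP ud.
have yhd := bpg_map_dom psiE psi_diff Omega_setT
  (sa_rho_proper standing) yhP.
have := bpg_map_subdifferential psiE psi_diff Omega_setT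
  (sa_rho_proper standing) (sa_rho_convex standing) l0 yhP u.
rewrite grad_mapE -(fin_rho yhd) -(fin_rho ud) -EFinD lee_fin => rho_ge.
have f_ge := Df_ge u x.
have gE : l * dotp (gmap l x yh) (gmap l x yh) = dotp (gmap l x yh) (x - yh).
  by rewrite {2}/gmap dotpZr mulrA divff ?mul1r // gt_eqF.
rewrite /P gE /phi; move: rho_ge f_ge; rewrite /Df.
by move: (gmap _ _ _) (dotp (u - x) (u - x)) => g sq; rewrite !dotpE; lra.
Qed.

Lemma tr_theta_affine s l k : st_theta s = 1 + mu * st_omega s ->
  tr_theta mu s l k = 1 + mu * tr_omega mu s l k.
Proof. by rewrite /tr_theta /tr_omega => ->; ring. Qed.

(** What a run preserves; [dom rho] is there so that [Phi] is finite at [y]. *)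
Record good_state s : Prop := GoodState {
  good_omega : 0 <= st_omega s;
  good_theta : st_theta s = 1 + mu * st_omega s;
  good_lambda : lambda_min <= st_lambda s <= lambda0;
  good_kappa : st_kappa s = kappa0;
  good_dom : dom rho (st_y s)
}.

(** The distance [D_psi(xs, z)] carries the weight [theta], which the strong
    convexity of [f] makes grow along the run. *)
Let energy xs s : R :=
  st_omega s * (phi (st_y s) - phi xs)
  + st_theta s / 2 * dotp (xs - st_z s) (xs - st_z s).

Record good_step s s' : Prop := GoodStep {
  step_good : good_state s';
  step_omega_gt0 : 0 < st_omega s';
  step_contraction : st_omega s <= (1 - q_min) * st_omega s';
  step_energy : forall xs, dom rho xs -> energy xs s' <= energy xs s
}.

Lemma grad_conjugate_psi p : grad (conjugate psi) p = p.
Proof. by rewrite (conjugate_psi psiE) (grad_psi psiE). Qed.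

Section Trial.
Variables (s : ga_state R n) (l : R).
Hypotheses (s_good : good_state s) (l_range : lambda_min <= l <= lambda0).

Local Notation alpha := (tr_alpha mu s l kappa0).
Local Notation omega' := (tr_omega mu s l kappa0).
Local Notation theta' := (tr_theta mu s l kappa0).
Local Notation x := (tr_x mu s l kappa0).
Local Notation zh yh := (tr_z psi mu s l kappa0 yh).

Let l_gt0 : 0 < l.
Proof. by case/andP: l_range => + _; apply: lt_le_trans; apply: lambda_min_gt0. Qed.

Lemma kappa0_gt_trial : 2 * mu * l < kappa0.
Proof.
case/andP: l_range => _ l_le; apply: le_lt_trans kappa0_gt.
by rewrite ler_pM2l // mulr_gt0.
Qed.

Let k_gt := kappa0_gt_trial.
Let omega_ge0 := good_omega s_good.

Let theta_gt0 : 0 < st_theta s.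
Proof. by rewrite good_theta // ltr_wpDr // mulr_ge0 // ltW. Qed.

Let alpha_gt0 := tr_alpha_gt0 mu_gt0 l_gt0 k_gt omega_ge0 theta_gt0.
Let omega'_gt0 := tr_omega_gt0 mu_gt0 l_gt0 k_gt omega_ge0 theta_gt0.
Let theta'_gt0 := tr_theta_gt0 mu_gt0 l_gt0 k_gt omega_ge0 theta_gt0.

Let theta'_ge : mu * omega' <= theta'.
Proof. by rewrite tr_theta_affine ?good_theta // lerDr ler01. Qed.

Lemma tr_zE yh : theta' *: zh yh =
  st_theta s *: st_z s + (mu * alpha) *: x - alpha *: gmap l x yh.
Proof.
rewrite /tr_z grad_conjugate_psi /tr_p !(grad_psi psiE) // grad_mapE.
by rewrite scalerA divff ?scale1r // gt_eqF.
Qed.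

(** A failure [l^-1 D_psi < D_f <= L D_psi] forces [1 / L < l]. *)
Lemma descent_fails_lambda yh :
  descent_fails psi f mu s l kappa0 yh -> lambda_min <= l / gamma_minus.
Proof.
rewrite /descent_fails bregman_f bregman_psiE -EFinM lte_fin => fails.
have D_ge0 : 0 <= dotp (yh - x) (yh - x) / 2 by rewrite divr_ge0 ?dotp_ge0.
have := lt_le_trans fails (Df_le yh x); rewrite -subr_gt0 -mulrBl => LlD.
have Ll : l^-1 < L.
  rewrite ltNge; apply/negP => Ll; move: LlD; rewrite ltNge => /negP; apply.
  by apply: mulr_le0_ge0; rewrite ?subr_le0.
have g0 : 0 < gamma_minus by apply: lt_trans gamma_minus_gt1.
rewrite /lambda_min ge_min; apply/orP; right.
rewrite div1r invfM mulrC ler_pM2r ?invr_gt0 //.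
by rewrite -[leRHS]invrK lef_pV2 ?posrE ?invr_gt0 // ltW.
Qed.

Lemma dual_point_always_ok yh : dual_point_ok psi mu s l kappa0 yh.
Proof.
rewrite /dual_point_ok (conjugate_psi psiE); move: Omega_setT.
by rewrite /Omega => ->.
Qed.

(** Once the descent test holds, [P l x yh >= l / 2 |g|^2], so the right-hand side
    dominates the one of [certificate_bound]. *)
Lemma certificate yh : ~ descent_fails psi f mu s l kappa0 yh ->
  theta' * (dotp (st_z s - zh yh) (st_z s - zh yh) / 2)
  - mu * (st_omega s * (dotp (st_y s - x) (st_y s - x) / 2)
          + alpha * (dotp (st_z s - x) (st_z s - x) / 2))
  <= omega' * P l x yh.
Proof.
rewrite {1}/descent_fails bregman_f bregman_psiE -EFinM lte_fin.
move=> /negP; rewrite -leNgt => descent.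
have kE := tr_alpha_eq l_gt0 k_gt omega_ge0 theta_gt0.
have xE := tr_x_balance mu_gt0 l_gt0 k_gt omega_ge0 theta_gt0.
have k4 : 4 <= kappa0 by apply: le_trans kappa0_ge8; rewrite ler_nat.
have zE : theta' *: (st_z s - zh yh) =
          alpha *: (mu *: (st_z s - x) + gmap l x yh).
  rewrite scalerBr tr_zE scalerDr scalerA [alpha * mu]mulrC scalerBr.
  rewrite /tr_theta scalerDl !opprD opprK.
  by rewrite !addrA [_ + _ *: st_z s]addrC addrK.
apply: le_trans (certificate_bound
  mu_gt0 alpha_gt0 omega_ge0 k4 theta'_ge kE xE zE) _.
rewrite -/(tr_omega mu s l kappa0); apply: ler_wpM2l; first exact: ltW.
rewrite /P; move: descent; rewrite dotp_gmap //; lra.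
Qed.

Lemma certificate_never_fails yh : ~ descent_fails psi f mu s l kappa0 yh ->
  ~ certificate_fails psi f mu s l kappa0 yh.
Proof.
move=> /certificate cert; rewrite /certificate_fails P_valE // !bregman_psiE.
by apply/negP; rewrite -leNgt; move: cert; rewrite -lee_fin.
Qed.

(** The energy decreases by adding [prox_gap] at [y] with weight [omega] and at
    [xs] with weight [alpha]: by the balance equation of [x] the linear terms sum
    to [alpha <g, xs - z>], which cancels against [dual_update_identity]. What
    remains is the inequality [certificate]. *)
Lemma accepted_trial yh : tr_candidate psi f rho mu s l kappa0 yh ->
  ~ descent_fails psi f mu s l kappa0 yh ->
  good_step s (GAState alpha omega' theta' x yh (zh yh) l kappa0).
Proof.
move=> [yhP _] descent; split => //=.
- split => //=; first exact: ltW.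
    by apply: tr_theta_affine; apply: good_theta.
  exact: (bpg_map_dom psiE psi_diff Omega_setT (sa_rho_proper standing) yhP).
- have kappa0_gt0 : 0 < kappa0 by apply: lt_trans k_gt; rewrite !mulr_gt0.
  apply: (tr_omega_contraction mu_gt0 l_gt0 k_gt omega_ge0 theta_gt0) => //.
  rewrite ler_pM2r ?invr_gt0 //.
  by case/andP: l_range => ? _; rewrite ler_pM2l // mulr_gt0.
move=> xs xsd; rewrite /energy /=.
have gap_y := ler_wpM2l omega_ge0
  (prox_gap l_gt0 yhP (good_dom s_good)).
have gap_xs := ler_wpM2l (ltW alpha_gt0) (prox_gap l_gt0 yhP xsd).
have cert := certificate descent.
have := dual_update_identity xs
  (erefl : theta' = st_theta s + mu * alpha) (tr_zE yh).
have xE := tr_x_balance mu_gt0 l_gt0 k_gt omega_ge0 theta_gt0.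
have gE : st_omega s * dotp (gmap l x yh) (st_y s - x)
          + alpha * dotp (gmap l x yh) (xs - x) =
          alpha * dotp (gmap l x yh) (xs - st_z s).
  have := congr1 (dotp (gmap l x yh)) xE; rewrite -[in RHS](scale0r 0).
  by move: (gmap _ _ _) => g; move: (tr_x _ _ _ _) => c; rewrite !dotpE; lra.
move: gap_y gap_xs cert gE; rewrite /tr_omega /=; lra.
Qed.

End Trial.

(** Inside the trial loop only [l] can vary: the exits (a), (e), (f), which would
    enlarge [kappa], are impossible, and (d) keeps [l] in its range. *)
Lemma completed_trials s s' l k :
  good_state s -> lambda_min <= l <= lambda0 -> k = kappa0 ->
  ga_trials psi f rho mu gamma_minus gamma_kappa s l k (Completed s') ->
  good_step s s'.
Proof.
move=> s_good l_range kE tr; move eqo: (Completed s') tr => o tr.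
elim: tr l_range kE eqo => {l k o}.
- move=> l k o k_le _ _ l_range kE; move: k_le.
  by rewrite kE leNgt (kappa0_gt_trial l_range).
- by [].
- move=> l k yh o _ _ fails _ IH l_range kE; apply: IH => //.
  rewrite kE in fails; rewrite (descent_fails_lambda l_range fails) /=.
  case/andP: l_range => l_ge; apply: le_trans.
  by rewrite ler_pdivrMr ?(lt_trans ltr01) // ler_peMr ?ltW //
     (lt_le_trans lambda_min_gt0).
- move=> l k yh o _ _ _ + _ _ _ kE; rewrite kE.
  by move=> /(_ (dual_point_always_ok _ _ _)).
- move=> l k yh o _ _ descent _ fails _ _ l_range kE.
  rewrite kE in descent fails.
  by case: (certificate_never_fails s_good l_range descent fails).
- move=> l k yh _ cand descent _ _ l_range kE [->].
  by rewrite kE in cand descent *; apply: accepted_trial.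
Qed.

Lemma completed_iteration s s' : good_state s ->
  ga_iteration psi f rho mu 1 gamma_minus gamma_kappa s (Completed s') ->
  good_step s s'.
Proof.
move=> s_good; move eqo: (Completed s') => o it; case: it eqo => // {}o _ tr eqo.
move: tr; rewrite -eqo mul1r divr1 => tr.
exact: completed_trials s_good (good_lambda s_good) (good_kappa s_good) tr.
Qed.

(** * Convergence rate of a run *)

Variables (y0 : 'rV[R]_n) (N : nat) (s : nat -> ga_state R n).
Hypothesis y0_dom : dom rho y0.
Hypothesis run :
  ga_run psi f rho mu y0 lambda0 kappa0 1 gamma_minus gamma_kappa N s.

Lemma run_good k : (k <= N)%N -> good_state (s k).
Proof.
elim: k => [_|k IH k_lt].
  case: run => [[[y0E _ om0 th0] [l0 k0]] _]; split => //.
  - by rewrite om0.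
  - by rewrite om0 mulr0 addr0.
  - by rewrite l0 lexx ge_min lexx.
  - by rewrite y0E.
have [_ /(_ k k_lt) it] := run.
exact: step_good (completed_iteration (IH (ltnW k_lt)) it).
Qed.

Lemma run_step k : (k < N)%N -> good_step (s k) (s k.+1).
Proof.
move=> k_lt; have [_ /(_ k k_lt)] := run.
exact: completed_iteration (run_good (ltnW k_lt)).
Qed.

Lemma run_energy xs k : dom rho xs -> (k <= N)%N ->
  energy xs (s k) <= energy xs (s 0%N).
Proof.
move=> xsd; elim: k => [//|k IH k_lt].
exact: le_trans (step_energy (run_step k_lt) xsd) (IH (ltnW k_lt)).
Qed.

Lemma subr_q_min_ge0 : (0 < N)%N -> 0 <= 1 - q_min.
Proof.
move=> N0; have step := run_step N0.
rewrite -(pmulr_lge0 _ (step_omega_gt0 step)).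
exact: le_trans (good_omega (run_good (leq0n N))) (step_contraction step).
Qed.

Lemma run_omega k : (k < N)%N ->
  st_omega (s 1%N) <= (1 - q_min) ^+ k * st_omega (s k.+1).
Proof.
elim: k => [|k IH] k_lt; first by rewrite expr0 mul1r.
apply: le_trans (IH (ltnW k_lt)) _; rewrite exprSr -mulrA.
apply: ler_wpM2l; last exact: step_contraction (run_step k_lt).
by rewrite exprn_ge0 // subr_q_min_ge0 // (leq_ltn_trans _ k_lt).
Qed.

Lemma run_rate xs : dom rho xs -> (0 < N)%N ->
  phi (st_y (s N)) - phi xs <=
  enorm (xs - y0) ^+ 2 / (2 * st_omega (s 1%N)) * (1 - q_min) ^+ N.-1.
Proof.
move=> xsd N0; have := run_energy xsd (leqnn N).
have [[[_ z0E om0 th0] _] _] := run.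
have good := run_good (leqnn N).
have omega1_gt0 := step_omega_gt0 (run_step N0).
have omegaN_gt0 : 0 < st_omega (s N).
  by rewrite -(prednK N0); apply: step_omega_gt0 (run_step _); rewrite prednK.
have := run_omega (k := N.-1); rewrite prednK // => /(_ (leqnn N)) omega_le.
rewrite /energy om0 th0 z0E mul0r add0r enorm_sqr => energy_le.
have E_ge0 := dotp_ge0 (xs - y0).
have dist_ge0 : 0 <= st_theta (s N) / 2 * dotp (xs - st_z (s N)) (xs - st_z (s N)).
  rewrite mulr_ge0 ?dotp_ge0 // divr_ge0 // (good_theta good) addr_ge0 //.
  by rewrite mulr_ge0 ?(good_omega good) // ltW.
rewrite -(ler_pM2l omegaN_gt0).
apply: (@le_trans _ _ (1 / 2 * dotp (xs - y0) (xs - y0))); first by lra.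
set D := dotp _ _ in E_ge0 *; set c := _ ^+ _ in omega_le *.
have -> : st_omega (s N) * (D / (2 * st_omega (s 1%N)) * c) =
          D / (2 * st_omega (s 1%N)) * (c * st_omega (s N)) by ring.
have -> : 1 / 2 * D = D / (2 * st_omega (s 1%N)) * st_omega (s 1%N).
  by field; rewrite gt_eqF.
by apply: ler_wpM2l omega_le; rewrite divr_ge0 // mulr_ge0 // ltW.
Qed.

Lemma minimizer_dom xs : Phi_minimizer psi f rho xs -> dom rho xs.
Proof.
move=> [_ xsE].
have : (Phi f rho xs <= Phi f rho y0)%E.
  rewrite xsE; apply: ereal_inf_lbound; exists y0 => //.
  by rewrite Omega_setT closureT.
rewrite (Phi_fin y0_dom) /Phi -fin_f /dom /=.
by case: (rho xs) (sa_rho_proper standing).1 => //= r _; rewrite ltry.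
Qed.

Lemma run_Phi_rate xs : Phi_minimizer psi f rho xs -> (1 <= N)%N ->
  (Phi f rho (st_y (s N)) - Phi_star psi f rho <=
   (enorm (xs - y0) ^+ 2 / (2 * st_omega (s 1%N)) * (1 - q_min) ^+ N.-1)%:E)%E.
Proof.
move=> xs_min N0; have xsd := minimizer_dom xs_min; case: xs_min => _ <-.
rewrite (Phi_fin xsd) (Phi_fin (good_dom (run_good (leqnn N)))) -EFinB lee_fin.
exact: run_rate.
Qed.

End Convergence.

Theorem mainTheorem5 (R : realType) (n : nat)
    (psi f rho : 'rV[R]_n -> \bar R) (L mu : R) (y0 : 'rV[R]_n)
    (lambda0 kappa0 gamma_plus gamma_minus gamma_kappa : R)
    (hstanding : standing_assumptions psi f rho L)
    (hsolvable : bpg_solvable psi f rho)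
    (hpsi : forall x, psi x = (enorm x ^+ 2 / 2)%:E)
    (hOmega : Omega psi = setT)
    (hmu : 0 < mu)
    (hstrong : rel_strongly_convex psi f mu)
    (hinputs : ga_inputs psi rho mu y0 lambda0 kappa0
                 gamma_plus gamma_minus gamma_kappa)
    (hgamma_plus : gamma_plus = 1)
    (hkappa8 : 8 <= kappa0)
    (hkappa_mu : 2 * mu * lambda0 < kappa0)
    (N : nat) (s : nat -> ga_state R n)
    (hrun : ga_run psi f rho mu y0 lambda0 kappa0
              gamma_plus gamma_minus gamma_kappa N s) :
  let lambda_min := Num.min lambda0 (1 / (gamma_minus * L)) in
  let q_min := Num.sqrt (2 * mu * lambda_min / kappa0) in
  (forall k, (1 <= k <= N)%N ->
     lambda_min <= st_lambda (s k) /\ st_kappa (s k) = kappa0) /\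
  (forall xstar : 'rV[R]_n, Phi_minimizer psi f rho xstar -> (1 <= N)%N ->
     (Phi f rho (st_y (s N)) - Phi_star psi f rho <=
      (enorm (xstar - y0) ^+ 2 / (2 * st_omega (s 1%N))
         * (1 - q_min) ^+ N.-1)%:E)%E).
Proof.
case: hinputs => -[_ [_ y0_dom] lambda0_gt0 _] [_ gamma_minus_gt1 _].
move=> lambda_min q_min.
move: hrun; rewrite hgamma_plus => run.
split=> [k /andP[_ k_le]|xs xs_min N_gt0].
  have good := run_good hpsi hOmega hstanding hmu hstrong hkappa8 hkappa_mu
    lambda0_gt0 gamma_minus_gt1 y0_dom run k_le.
  by split; [case/andP: (good_lambda good) | exact: good_kappa good].
exact: (run_Phi_rate hpsi hOmega hstanding hmu hstrong hkappa8 hkappa_mu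
  lambda0_gt0 gamma_minus_gt1 y0_dom run xs_min N_gt0).
Qed.
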